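(* There is a relational signature $\sigma$ and a sequence $(\phi_h)_{h\geq 1}$ of first-order sentences over $\sigma$ of size $O(h)$ such that for each $h\geq 1$, every sentence in Barthelmann-Schwentick normal form that is equivalent to $\phi_h$ on all $\sigma$-structures of degree $\leq 2$ has size $>2^{2^h+1}$.
   Context: Structures are finite with non-empty universe; the degree of a structure is the maximum degree of its Gaifman graph (vertices the elements, edges between distinct elements occurring together in some tuple of some relation). The size of a formula is its length as a word. A formula $\phi(\overline{y},z)$ is $r$-local around $z$ if for every structure $\mathcal{A}$ and all tuples, $\mathcal{A}\models\phi[\overline{a},c]$ iff $\mathcal{A}[\{\text{entries of }\overline{a}\}\cup N_r^{\mathcal{A}}(c)]\models\phi[\overline{a},c]$, where $N_r^{\mathcal{A}}(c)$ is the set of elements at Gaifman distance $\leq r$ from $c$. A sentence is in Barthelmann-Schwentick normal form if it has the form $\exists y_1\cdots\exists y_n\forall z\,\phi(y_1,\dots,y_n,z)$ with $n\ge0$ and $\phi$ $r$-local around $z$ for some $r\geq0$. *)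

(* Defs.v *)
From HB Require Import structures.
From mathcomp Require Import all_boot.

Set Implicit Arguments.
Unset Strict Implicit.
Unset Printing Implicit Defensive.

Record signature := Signature {
  sym : finType;
  ar : sym -> nat;
  ar_gt0 : forall R : sym, 0 < ar R }.

Definition var := nat.

Inductive formula (sg : signature) : Type :=
| Eq of var & var
| Rel (R : sym sg) of (ar R).-tuple var
| Not of formula sg
| And of formula sg & formula sg
| Or of formula sg & formula sg
| Imp of formula sg & formula sg
| Iff of formula sg & formula sg
| Ex of var & formula sg
| All of var & formula sg.

Arguments Eq {sg}.
Arguments Rel {sg}.

(* Every variable and every relation symbol is a single letter. *)
Inductive letter (sg : signature) : Type :=
| LVar of var
| LRel of sym sg
| LEq | LNot | LAnd | LOr | LImp | LIff | LEx | LAll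
| LLpar | LRpar | LComma.

Arguments LVar {sg}.
Arguments LRel {sg}.
Arguments LEq {sg}.
Arguments LNot {sg}.
Arguments LAnd {sg}.
Arguments LOr {sg}.
Arguments LImp {sg}.
Arguments LIff {sg}.
Arguments LEx {sg}.
Arguments LAll {sg}.
Arguments LLpar {sg}.
Arguments LRpar {sg}.
Arguments LComma {sg}.

Section Syntax.
Variable sg : signature.

Fixpoint arg_word (xs : seq var) : seq (letter sg) :=
  match xs with
  | [::] => [::]
  | [:: x] => [:: LVar x]
  | x :: xs' => [:: LVar x, LComma & arg_word xs']
  end.

Fixpoint word (phi : formula sg) : seq (letter sg) :=
  let binary c p q := LLpar :: word p ++ c :: word q ++ [:: LRpar] in
  match phi with
  | Eq x y => [:: LVar x; LEq; LVar y]
  | Rel R xs => [:: LRel R, LLpar & arg_word xs ++ [:: LRpar]]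
  | Not p => LNot :: word p
  | And p q => binary LAnd p q
  | Or p q => binary LOr p q
  | Imp p q => binary LImp p q
  | Iff p q => binary LIff p q
  | Ex x p => [:: LEx, LVar x & word p]
  | All x p => [:: LAll, LVar x & word p]
  end.

Definition fsize (phi : formula sg) : nat := size (word phi).

Fixpoint fv (phi : formula sg) : seq var :=
  match phi with
  | Eq x y => [:: x; y]
  | Rel R xs => xs
  | Not p => fv p
  | And p q | Or p q | Imp p q | Iff p q => fv p ++ fv q
  | Ex x p | All x p => [seq y <- fv p | y != x]
  end.

Definition sentence (phi : formula sg) : Prop := fv phi = [::].

End Syntax.

Record structure (sg : signature) := Structure {
  univ :> finType;
  univ_gt0 : 0 < #|univ|;
  interp : forall R : sym sg, {set (ar R).-tuple univ} }.

Section Semantics.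
Variable sg : signature.

Definition upd (A : structure sg) (s : var -> A) (x : var) (a : A) : var -> A :=
  fun y => if y == x then a else s y.

Fixpoint sat (A : structure sg) (s : var -> A) (phi : formula sg) : bool :=
  match phi with
  | Eq x y => s x == s y
  | Rel R xs => map_tuple s xs \in interp A R
  | Not p => ~~ sat s p
  | And p q => sat s p && sat s q
  | Or p q => sat s p || sat s q
  | Imp p q => sat s p ==> sat s q
  | Iff p q => sat s p == sat s q
  | Ex x p => [exists a : A, sat (upd s x a) p]
  | All x p => [forall a : A, sat (upd s x a) p]
  end.

(* Meant for sentences, whose truth value does not depend on s. *)
Definition models (A : structure sg) (phi : formula sg) : Prop :=
  forall s : var -> A, sat s phi.

Definition gaifman (A : structure sg) : rel A := fun a b =>
  (a != b) && [exists R : sym sg, exists t in interp A R, (a \in t) && (b \in t)].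

Definition degree (A : structure sg) : nat :=
  \max_(a : A) #|[set b | gaifman a b]|.

Definition dist_le (A : structure sg) (r : nat) (a b : A) : bool :=
  [exists k : 'I_r.+1, exists p : k.-tuple A,
     path (@gaifman A) a p && (last a p == b)].

Definition nbhd (A : structure sg) (r : nat) (c : A) : {set A} :=
  [set b | dist_le r c b].

Lemma nbhd_center (A : structure sg) (r : nat) (c : A) : c \in nbhd r c.
Proof.
rewrite inE; apply/existsP; exists ord0; apply/existsP.
by exists [tuple]; rewrite /= eqxx.
Qed.

Lemma induced_gt0 (A : structure sg) (S : {set A}) (c : A) :
  c \in S -> 0 < #|{: {x : A | x \in S}}|.
Proof. by move=> cS; apply/card_gt0P; exists (exist _ c cS). Qed.

(* The induced substructure A[S]; the element c only witnesses that S is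
   non-empty. *)
Definition induced (A : structure sg) (S : {set A}) (c : A) (cS : c \in S) :
    structure sg :=
  @Structure sg {x : A | x \in S} (induced_gt0 cS)
    (fun R => [set t | map_tuple val t \in interp A R]).

Definition local_set (A : structure sg) (r : nat) (ys : seq var) (z : var)
    (s : var -> A) : {set A} :=
  [set a in map s ys] :|: nbhd r (s z).

Lemma local_set_center (A : structure sg) r ys z (s : var -> A) :
  s z \in local_set r ys z s.
Proof. by rewrite inE nbhd_center orbT. Qed.

Definition local_structure (A : structure sg) (r : nat) (ys : seq var) (z : var)
    (s : var -> A) : structure sg :=
  induced (local_set_center r ys z s).

(* s, seen as an assignment in the local structure. On ys and z it keeps its
   values; values outside the local set (possible only for other variables)
   are replaced by s z. *)
Definition local_asg (A : structure sg) (r : nat) (ys : seq var) (z : var)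
    (s : var -> A) : var -> local_structure r ys z s :=
  fun x => insubd (exist _ (s z) (local_set_center r ys z s)) (s x).

Lemma local_asgE (A : structure sg) r ys z (s : var -> A) x :
  x \in rcons ys z -> val (local_asg r ys z s x) = s x.
Proof.
rewrite mem_rcons inE => xyz; rewrite val_insubd.
case: ifPn => // /negP[]; case/predU1P: xyz => [->|xys].
  exact: local_set_center.
by rewrite !inE map_f.
Qed.

(* The tuples a, c interpreting ys, z are given by the assignment s; this
   presupposes that the free variables of phi are among ys, z. *)
Definition local_around (r : nat) (ys : seq var) (z : var) (phi : formula sg) :
    Prop :=
  forall (A : structure sg) (s : var -> A),
    sat s phi <-> sat (local_asg r ys z s) phi.

(* As usual for the notation phi(y_1, ..., y_n, z), the variables y_1, ..., y_n,
   z are pairwise distinct and include all free variables of phi. *)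
Definition bs_normal_form (psi : formula sg) : Prop :=
  exists (ys : seq var) (z : var) (phi : formula sg),
    [/\ psi = foldr (@Ex sg) (All z phi) ys,
        uniq (rcons ys z),
        {subset fv phi <= rcons ys z}
      & exists r : nat, local_around r ys z phi].

Definition equivalent_deg (d : nat) (phi psi : formula sg) : Prop :=
  forall A : structure sg, degree A <= d -> (models A phi <-> models A psi).

End Semantics.

(* Main.v *)
(** Words of length [2^h] are written on labelled cycles of [2^h] nodes; each
    cycle carries a root marked with a side.  The sentence [words_matched h] says
    that the word read from any root of the first side is also read from some
    root of the second side; halving the distance recursively keeps it of size [O(h)].
    Consider the structure with one cycle for every word on either side.  If a
    normal form has fewer than [2^(2^h)] existential variables, their witnesses
    miss some cycle of the second side.  Deleting that cycle changes neither
    the witnesses nor any neighbourhood of the remaining elements, so the normal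
    form stays true, whereas [words_matched h] becomes false. *)
Require Import Defs.
From mathcomp Require Import all_boot.

Set Implicit Arguments.
Unset Strict Implicit.
Unset Printing Implicit Defensive.

(** * Semantics of formulas *)

Section Formulas.
Variable sg : signature.
Implicit Types (A B : structure sg) (phi : formula sg).

Lemma eq_sat_fv A phi (s t : var -> A) :
  {in fv phi, s =1 t} -> sat s phi = sat t phi.
Proof.
have updE x p (s' t' : var -> A) a :
    {in [seq y <- fv p | y != x], s' =1 t'} ->
    {in fv p, upd s' x a =1 upd t' x a}.
  move=> st y yp; rewrite /upd; case: eqP => [//|/eqP yx].
  by apply: st; rewrite mem_filter yx.
elim: phi s t => [x y|R xs|p IHp|p IHp q IHq|p IHp q IHq|p IHp q IHq
  |p IHp q IHq|x p IHp|x p IHp] s t /= st.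
- by rewrite !st ?inE ?eqxx ?orbT.
- rewrite (_ : map_tuple s xs = map_tuple t xs) //.
  by apply: val_inj; apply/eq_in_map => x /st.
- by rewrite (IHp s t).
1-4: by rewrite (IHp s t) ?(IHq s t) // => x xp; apply: st;
  rewrite mem_cat xp ?orbT.
- by apply: eq_existsb => a; apply: IHp; apply: updE.
- by apply: eq_forallb => a; apply: IHp; apply: updE.
Qed.

(* An isomorphism between [A] and [B], given as a pair of injections with the
   same range. *)
Lemma sat_iso (T : Type) A B (f : A -> T) (g : B -> T) phi
    (s : var -> A) (t : var -> B) :
  injective f -> injective g ->
  (forall a, exists b, f a = g b) -> (forall b, exists a, f a = g b) ->
  (forall R (u : (ar R).-tuple A) (v : (ar R).-tuple B),
     map f u = map g v -> (u \in interp A R) = (v \in interp B R)) ->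
  (forall x, f (s x) = g (t x)) -> sat s phi = sat t phi.
Proof.
move=> f_inj g_inj fg gf relE.
have updE x a b (s' : var -> A) (t' : var -> B) :
    (forall y, f (s' y) = g (t' y)) -> f a = g b ->
    forall y, f (upd s' x a y) = g (upd t' x b y).
  by move=> st ab y; rewrite /upd; case: ifP.
elim: phi s t => [x y|R xs|p IHp|p IHp q IHq|p IHp q IHq|p IHp q IHq
  |p IHp q IHq|x p IHp|x p IHp] s t /= st.
- apply/eqP/eqP => e; first by apply: g_inj; rewrite -!st e.
  by apply: f_inj; rewrite !st e.
- by apply: relE; rewrite -!map_comp; apply: eq_map.
- by rewrite (IHp s t).
1-4: by rewrite (IHp s t) ?(IHq s t).
- apply/existsP/existsP => -[].
    move=> a; have [b ab] := fg a; move=> sa; exists b.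
    by rewrite -(IHp (upd s x a)) //; apply: updE.
  move=> b; have [a ab] := gf b; move=> sb; exists a.
  by rewrite (IHp _ (upd t x b)) //; apply: updE.
- apply/forallP/forallP => H.
    move=> b; have [a ab] := gf b.
    by rewrite -(IHp (upd s x a)) //; apply: updE.
  move=> a; have [b ab] := fg a.
  by rewrite (IHp _ (upd t x b)) //; apply: updE.
Qed.

Lemma sat_foldr_Ex A (xs : seq var) phi (s : var -> A) :
  sat s (foldr (@Ex sg) phi xs) <->
  exists2 t : var -> A, (forall x, x \notin xs -> t x = s x) & sat t phi.
Proof.
elim: xs s => [|y xs IHxs] s /=.
  split=> [sp|[t ts]]; first by exists s.
  by rewrite (@eq_sat_fv _ _ t s) // => x _; apply: ts.
split=> [/existsP[a] /IHxs[t ts tp]|[t ts tp]].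
  exists t => // x; rewrite inE negb_or => /andP[xy xxs].
  by rewrite ts // /upd (negPf xy).
apply/existsP; exists (t y); apply/IHxs; exists t => // x xxs.
rewrite /upd; case: eqP => [->//|/eqP xy].
by apply: ts; rewrite inE negb_or xy.
Qed.

Lemma fsize_foldr_Ex (xs : seq var) phi :
  fsize (foldr (@Ex sg) phi xs) = (size xs).*2 + fsize phi.
Proof. by elim: xs => //= x xs; rewrite /fsize /= => ->. Qed.

End Formulas.

(** * Locality and unions of components *)

Section Components.
Variables (sg : signature) (A : structure sg) (S : {set A}) (c : A).
Variable cS : c \in S.
Hypothesis S_closed : forall a b, a \in S -> gaifman a b -> b \in S.

Let B := induced cS.
Let emb (b : B) : A := val b.

Let emb_inj : injective emb. Proof. exact: val_inj. Qed.

Let embS b : emb b \in S. Proof. exact: valP. Qed.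

Let embP a : a \in S -> exists b, a = emb b.
Proof. by move=> aS; exists (exist _ a aS). Qed.

(** A tuple with an entry in [S] lies entirely in [S], because its other entries are Gaifman
    neighbours of that one. Hence no tuple witnessing adjacency is lost in the induced structure. *)
Lemma gaifman_induced (a b : B) : gaifman a b = gaifman (emb a) (emb b).
Proof.
rewrite /gaifman (inj_eq emb_inj); case: eqVneq => //= ab.
apply/existsP/existsP => -[R] /existsP[t] /and3P[tR at_ bt]; exists R.
  apply/existsP; exists (map_tuple emb t).
  by move: tR; rewrite inE => -> /=; rewrite !map_f.
have tS x : x \in t -> x \in S.
  move=> xt; case: (eqVneq (emb a) x) => [<-//|ax].
  apply: (S_closed (embS a)); rewrite /gaifman ax.
  by apply/existsP; exists R; apply/existsP; exists t; rewrite tR at_.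
have tE : map emb (map (insubd a) t) = t.
  rewrite -map_comp map_id_in // => x /tS xS /=.
  by rewrite /emb val_insubd xS.
(* All entries of [t] are in [S], so the default [a] is never taken. *)
apply/existsP; exists (map_tuple (insubd a) t); rewrite inE.
rewrite -!(mem_map emb_inj) tE at_ bt !andbT.
by rewrite (_ : map_tuple _ _ = t) //; apply: val_inj.
Qed.

(** A path that starts in [S] cannot leave it, so [A] offers no shortcut between elements of [B]. *)
Lemma dist_le_induced r (a b : B) : dist_le r a b = dist_le r (emb a) (emb b).
Proof.
have map_path_emb (q : seq B) x :
    path (@gaifman _ A) (emb x) (map emb q) = path (@gaifman _ B) x q.
  by elim: q x => //= y q IHq x; rewrite IHq gaifman_induced.
apply/existsP/existsP => -[k] /existsP[p] /andP[pP /eqP lastp]; exists k.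
  apply/existsP; exists (map_tuple emb p).
  by rewrite map_path_emb pP last_map lastp /=.
have [q pq] : exists q, p = map emb q :> seq A.
  elim: (tval p) (a) (pP) => [|y q IHq] x /=; first by exists [::].
  case/andP=> /(S_closed (embS x))/embP[{}y ->] /IHq[l ->].
  by exists (y :: l).
have qk : size q == k by rewrite -(size_map emb) -pq size_tuple.
apply/existsP; exists (Tuple qk); move: pP lastp.
by rewrite pq map_path_emb last_map => -> /emb_inj -> /=.
Qed.

Lemma local_set_induced r ys z (s : var -> B) b :
  (b \in local_set r ys z s) = (emb b \in local_set r ys z (emb \o s)).
Proof.
by rewrite !inE dist_le_induced map_comp (mem_map emb_inj).
Qed.

Lemma local_set_sub r ys z (s : var -> B) a :
  a \in local_set r ys z (emb \o s) -> a \in S.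
Proof.
rewrite !inE => /orP[/mapP[y _ ->]|]; first exact: embS.
case/existsP=> k /existsP[p] /andP[/= pP /eqP <-].
elim: (tval p) (s z) (pP) => [|y q IHq] x /=; first by rewrite embS.
by case/andP=> /(S_closed (embS x))/embP[{}y ->]; apply: IHq.
Qed.

(** Locality reduces both sides to local structures, and [emb] maps the one in [B] isomorphically
    onto the one in [A], since neighbourhoods never leave [S]. *)
Lemma sat_induced_local r ys z (phi : formula sg) (s : var -> B) :
  local_around r ys z phi -> sat s phi = sat (emb \o s) phi.
Proof.
move=> loc; suff locE : sat (local_asg r ys z s) phi =
    sat (local_asg r ys z (emb \o s)) phi.
  by apply/idP/idP => /loc H; apply/loc; rewrite ?locE // -locE.
have lsE := local_set_induced r ys z s.
apply: (@sat_iso _ A (local_structure r ys z s)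
  (local_structure r ys z (emb \o s)) (fun a => emb (val a)) val).
- by move=> a b /emb_inj/val_inj.
- exact: val_inj.
- move=> [b bP] /=; have := bP; rewrite lsE => bP'.
  by exists (exist _ (emb b) bP').
- move=> [a aP] /=; have [b ab] := embP (local_set_sub aP).
  by have := aP; rewrite ab -lsE => bP; exists (exist _ b bP).
- move=> R u v uv; rewrite !inE.
  rewrite (_ : map_tuple _ (map_tuple _ u) = map_tuple val v) //.
  by apply: val_inj; rewrite /= -uv -map_comp.
(* The defaults of the two local assignments, [s z] and [emb (s z)], correspond as well, so the
   assignments match on all variables. *)
- by move=> x; rewrite /local_asg val_insubd /= val_insubd lsE; case: ifP.
Qed.

End Components.

(** * The sentences *)

(* [(true, c)] is the relation of [c]-labelled edges, [(false, b)] the set of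
   roots of side [b]. *)
Definition cycle_ar (R : bool * bool) : nat := if R.1 then 2 else 1.

Lemma cycle_ar_gt0 R : 0 < cycle_ar R.
Proof. by rewrite /cycle_ar; case: ifP. Qed.

Definition cycle_sig : signature := Signature cycle_ar_gt0.

Definition edge (c : bool) (x y : var) : formula cycle_sig :=
  @Rel cycle_sig (true, c) [tuple x; y].

Definition rooted (b : bool) (x : var) : formula cycle_sig :=
  @Rel cycle_sig (false, b) [tuple x].

Definition eq4 (x1 y1 x2 y2 x3 y3 x4 y4 : var) : formula cycle_sig :=
  And (And (Eq x1 y1) (Eq x2 y2)) (And (Eq x3 y3) (Eq x4 y4)).

(* Two conjoined copies of [p], for the paths through midpoints 4 and 5,
   expressed with a single occurrence of [p]. *)
Definition halves (p : formula cycle_sig) : formula cycle_sig :=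
  Ex 4 (Ex 5 (All 6 (All 7 (All 8 (All 9
    (Imp (Or (eq4 6 0 7 4 8 2 9 5) (eq4 6 4 7 1 8 5 9 3))
      (Ex 0 (Ex 1 (Ex 2 (Ex 3 (And (eq4 0 6 1 7 2 8 3 9) p))))))))))).

(* There are walks of length [2^k] from 0 to 1 and from 2 to 3 reading the same
   word. *)
Fixpoint same_word (k : nat) : formula cycle_sig :=
  match k with
  | 0 => Or (And (edge true 0 1) (edge true 2 3))
            (And (edge false 0 1) (edge false 2 3))
  | k'.+1 => halves (same_word k')
  end.

Definition words_matched (h : nat) : formula cycle_sig :=
  All 0 (Imp (rooted true 0)
    (Ex 2 (And (rooted false 2) (Ex 1 (Ex 3 (same_word h)))))).

(** Variables 6 to 9 range over the two quadruples describing the first and the second half.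
    Rebinding 0 to 3 to their values lets the single [p] be evaluated at both. *)
Lemma sat_halves (A : structure cycle_sig) p (P : A -> A -> A -> A -> Prop) s :
  (forall t : var -> A, sat t p <-> P (t 0) (t 1) (t 2) (t 3)) ->
  sat s (halves p) <->
  exists u v, P (s 0) u (s 2) v /\ P u (s 1) v (s 3).
Proof.
move=> pP; split=> [/existsP[u] /existsP[v] H|[u [v [Pl Pr]]]].
  exists u, v.
  have half a a' b b' :
      [&& a == s 0, a' == u, b == s 2 & b' == v] ||
      [&& a == u, a' == s 1, b == v & b' == s 3] -> P a a' b b'.
    move=> E; move/forallP/(_ a)/forallP/(_ a')/forallP/(_ b)/forallP/(_ b'): H.
    rewrite /= /upd /= -!andbA E /=.
    case/existsP=> c /existsP[c'] /existsP[d] /existsP[d'].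
    rewrite -!andbA => /and5P[/eqP <- /eqP <- /eqP <- /eqP <-].
    by move/pP.
  by split; apply: half; rewrite !eqxx ?orbT.
apply/existsP; exists u; apply/existsP; exists v.
apply/forallP=> a; apply/forallP=> a'; apply/forallP=> b; apply/forallP=> b'.
apply/implyP=> E; apply/existsP; exists a; apply/existsP; exists a'.
apply/existsP; exists b; apply/existsP; exists b'.
apply/andP; split; first by rewrite /= /upd /= !eqxx.
apply/pP; move: E; rewrite /= /upd /= -!andbA.
by case/orP=> /and4P[/eqP-> /eqP-> /eqP-> /eqP->].
Qed.

Lemma fv_same_word k : {subset fv (same_word k) <= [:: 0; 1; 2; 3]}.
Proof.
elim: k => [|k IHk] x; first by rewrite /= !inE; do !case: eqP => //=.
cbn [fv same_word halves eq4]; rewrite !(mem_filter, mem_cat, inE).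
by do 10 (case: eqP => //= ?); move/IHk; rewrite !inE; do !case: eqP.
Qed.

Lemma sentence_words_matched h : sentence (words_matched h).
Proof.
rewrite /sentence; case E: (fv _) => [//|x l].
have : x \in fv (words_matched h) by rewrite E mem_head.
cbn [fv words_matched rooted]; rewrite !(mem_filter, mem_cat, inE).
case: (x =P 0) => //= x0; case: (x =P 2) => //= x2.
case: (x =P 1) => //= x1; case: (x =P 3) => //= x3 /fv_same_word.
by rewrite !inE; do !case: eqP.
Qed.

Lemma fsize_And (sg : signature) (p q : formula sg) :
  fsize (And p q) = (fsize p + fsize q).+3.
Proof. by rewrite /fsize /= size_cat /= size_cat addn1 !addnS. Qed.

Lemma fsize_Imp (sg : signature) (p q : formula sg) :
  fsize (Imp p q) = (fsize p + fsize q).+3.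
Proof. by rewrite /fsize /= size_cat /= size_cat addn1 !addnS. Qed.

Lemma fsize_Ex (sg : signature) x (p : formula sg) :
  fsize (Ex x p) = (fsize p).+2.
Proof. by []. Qed.

Lemma fsize_All (sg : signature) x (p : formula sg) :
  fsize (All x p) = (fsize p).+2.
Proof. by []. Qed.

(** Each level costs a constant, since [halves p] contains [p] only once. *)
Lemma fsize_same_word k : fsize (same_word k) = 92 * k + 33.
Proof.
have fsizeS j : fsize (same_word j.+1) = 92 + fsize (same_word j).
  by rewrite /= /halves !(fsize_Ex, fsize_All, fsize_Imp, fsize_And).
by elim: k => // k IHk; rewrite fsizeS IHk mulnS addnA.
Qed.

Lemma fsize_words_matched h : 0 < h -> fsize (words_matched h) <= 200 * h.
Proof.
move=> h_gt0; rewrite /words_matched.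
rewrite !(fsize_Ex, fsize_All, fsize_Imp, fsize_And) fsize_same_word.
rewrite (addnC (92 * h)) [leqLHS](_ : _ = 55 + 92 * h) //.
(* It remains to see that [55 <= 108 * h], which follows from [0 < h]. *)
by rewrite -[200]/(108 + 92) mulnDl leq_add2r (leq_trans _ (leq_pmulr _ h_gt0)).
Qed.

(** * Cycles *)

(* Side, word and position. *)
Definition node (n : nat) : finType :=
  (bool * {ffun 'I_n -> bool} * 'I_n)%type.

Section Cycles.
Variable n : nat.
Implicit Types x y : node n.

Definition next x : node n := (x.1, ordS x.2).

Definition label x : bool := x.1.2 x.2.

Definition is_root (b : bool) x : bool := (x.1.1 == b) && (val x.2 == 0).

(** Defined on sequences of nodes, so that the same predicate describes a structure through any
    embedding into the nodes. *)
Definition holds (R : bool * bool) (t : seq (node n)) : bool :=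
  match R, t with
  | (true, c), [:: x; y] => (y == next x) && (label x == c)
  | (false, b), [:: x] => is_root b x
  | _, _ => false
  end.

Lemma next_inj : injective next.
Proof.
move=> [x i] [y j] /eqP; rewrite xpair_eqE => /andP[/eqP/= -> /eqP/=].
by move/(can_inj (@ordSK n)) ->.
Qed.

Lemma iter_next k x : iter k next x = (x.1, iter k (@ordS n) x.2).
Proof. by elim: k => [|k IHk]; [case: x|rewrite /= IHk]. Qed.

Lemma val_iter_ordS k (i : 'I_n) :
  val i = 0 -> k < n -> val (iter k (@ordS n) i) = k.
Proof.
move=> i0; elim: k => [|k IHk] // kn.
by rewrite /= IHk ?modn_small // ltnW.
Qed.

Section Embedded.
(** This covers both the structure of all cycles, with [emb] the identity, and the one with a cycle
    deleted, with [emb] the inclusion. *)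
Variables (A : structure cycle_sig) (emb : A -> node n).
Hypothesis emb_inj : injective emb.
Hypothesis interpE : forall R (t : (ar R).-tuple A),
  (t \in interp A R) = holds R (map emb t).

Lemma gaifman_next (a b : A) :
  gaifman a b -> emb b = next (emb a) \/ emb a = next (emb b).
Proof.
case/andP=> ab /existsP[[[] c] /existsP[t]]; rewrite interpE.
  case: t => -[|x [|y []]] //= i /and3P[/andP[/eqP yx _]].
  rewrite !inE => /orP[]/eqP ax /orP[]/eqP bx; subst a b; rewrite ?eqxx in ab.
  - by [].
  - by left.
  - by right.
  - by [].
case: t => -[|x []] //= i /and3P[_]; rewrite !inE => /eqP ax /eqP bx.
by rewrite ax bx eqxx in ab.
Qed.

Lemma degree_cycles : degree A <= 2.
Proof.
apply/bigmax_leqP => a _; rewrite -(card_imset _ emb_inj).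
(* The only possible neighbours are the successor and the predecessor on the cycle; the latter is
   [finv next], as [next] is injective. *)
apply: (@leq_trans #|[set next (emb a); finv next (emb a)]|); last first.
  by rewrite cards2; case: (_ != _).
apply/subset_leq_card/subsetP => x /imsetP[b]; rewrite inE => ab ->.
rewrite !inE; have [->|->] := gaifman_next ab; first by rewrite eqxx.
by rewrite (finv_f next_inj) eqxx orbT.
Qed.

Definition reads_same k (a a' b b' : A) : Prop :=
  [/\ emb a' = iter k next (emb a), emb b' = iter k next (emb b)
    & forall j, j < k -> label (iter j next (emb a)) =
                         label (iter j next (emb b))].

Hypothesis next_closed : forall a, exists b, emb b = next (emb a).

Lemma iter_next_closed k a : exists b, emb b = iter k next (emb a).
Proof.
elim: k => [|k [b IHk]]; first by exists a.
by have [b' b'E] := next_closed b; exists b'; rewrite b'E IHk.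
Qed.

(** The walks are cut after [k] steps; [next_closed] guarantees that the midpoints belong to [A]. *)
Lemma reads_sameD k l a a' b b' :
  reads_same (k + l) a a' b b' <->
  exists u v, reads_same k a u b v /\ reads_same l u a' v b'.
Proof.
split=> [[aE bE lE]|[u [v [[uE vE lE] [aE bE lE']]]]].
  have [u uE] := iter_next_closed k a; have [v vE] := iter_next_closed k b.
  exists u, v; split; split=> //.
  - by move=> j jk; apply: lE; rewrite (leq_trans jk) ?leq_addr.
  - by rewrite uE -iterD addnC.
  - by rewrite vE -iterD addnC.
  - by move=> j jl; rewrite uE vE -!iterD lE // addnC ltn_add2l.
split; [by rewrite aE uE -iterD addnC|by rewrite bE vE -iterD addnC|].
move=> j jkl; case: (ltnP j k) => [/lE //|kj].
rewrite -(subnK kj) !iterD -uE -vE lE' //.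
by rewrite -(ltn_add2l k) subnKC.
Qed.

Lemma sat_edge c (x y : var) (s : var -> A) :
  sat s (edge c x y) =
  (emb (s y) == next (emb (s x))) && (label (emb (s x)) == c).
Proof. exact: (@interpE (true, c) (map_tuple s [tuple x; y])). Qed.

Lemma sat_rooted b (x : var) (s : var -> A) :
  sat s (rooted b x) = is_root b (emb (s x)).
Proof. exact: (@interpE (false, b) (map_tuple s [tuple x])). Qed.

Lemma sat_same_word k (s : var -> A) :
  sat s (same_word k) <-> reads_same (2 ^ k) (s 0) (s 1) (s 2) (s 3).
Proof.
elim: k s => [|k IHk] s.
  cbn [sat same_word]; rewrite !sat_edge /reads_same expn0 /=; split.
    case/orP=> /andP[/andP[/eqP-> /eqP ax] /andP[/eqP-> /eqP bx]];
      by split=> // -[]// _; rewrite /= ax bx.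
  case=> -> -> /(_ 0 isT) /= ->; rewrite !eqxx /=.
  by case: (label _).
rewrite expnS mul2n -addnn; split.
  by move/(sat_halves _ IHk)/reads_sameD.
by move/reads_sameD/(sat_halves _ IHk).
Qed.

Lemma sat_words_matched h (s : var -> A) :
  sat s (words_matched h) <->
  forall a, is_root true (emb a) ->
    exists2 b, is_root false (emb b) &
      forall j, j < 2 ^ h -> label (iter j next (emb a)) =
                             label (iter j next (emb b)).
Proof.
cbn [sat words_matched]; split=> [/forallP H a ra|H].
  move: (H a) => /implyP; rewrite sat_rooted => /(_ ra)/existsP[b] /andP[].
  rewrite sat_rooted => rb /existsP[a'] /existsP[b'].
  by move/sat_same_word => [_ _ abE]; exists b.
apply/forallP=> a; apply/implyP; rewrite sat_rooted => /H[b rb abE].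
apply/existsP; exists b; apply/andP; split; first by rewrite sat_rooted.
have [a' aE] := iter_next_closed (2 ^ h) a.
have [b' bE] := iter_next_closed (2 ^ h) b.
by apply/existsP; exists a'; apply/existsP; exists b'; apply/sat_same_word.
Qed.

End Embedded.
End Cycles.

(** * Deleting a cycle *)

Section Deletion.
Variable h : nat.
Let n := 2 ^ h.
Let origin : 'I_n := Ordinal (expn_gt0 2 h).

Definition start (b : bool) (w : {ffun 'I_n -> bool}) : node n :=
  (b, w, origin).

Lemma is_rootP b (x : node n) : is_root b x -> x = start b x.1.2.
Proof.
case: x => [[b' w] i] /andP[/eqP/= -> /eqP i0].
by congr (_, _); apply: val_inj.
Qed.

Lemma label_start b w j (jn : j < n) :
  label (iter j (@next n) (start b w)) = w (Ordinal jn).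
Proof.
rewrite iter_next /label /=; congr (w _); apply: val_inj => /=.
exact: val_iter_ordS.
Qed.

Lemma node_gt0 : 0 < #|node n|.
Proof. by apply/card_gt0P; exists (start true [ffun=> true]). Qed.

Definition all_cycles : structure cycle_sig :=
  @Structure cycle_sig (node n) node_gt0 (fun R => [set t | holds R (tval t)]).

Let interp_all R (t : (ar R).-tuple all_cycles) :
  (t \in interp all_cycles R) = holds R (map id t).
Proof. by rewrite map_id inE. Qed.

(** The match of a root is the root of the cycle for the same word on the other side. *)
Lemma all_cycles_matched : models all_cycles (words_matched h).
Proof.
move=> s; apply/(sat_words_matched interp_all) => [a|a].
  by exists (next a).
move=> /is_rootP ->; exists (start false a.1.2).
  by rewrite /is_root /= !eqxx.
by move=> j jn; rewrite !label_start.
Qed.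

Variable w : {ffun 'I_n -> bool}.

Definition kept : {set all_cycles} :=
  [set x : node n | x.1 != (false, w)].

Lemma start_kept : start true w \in kept.
Proof. by rewrite inE. Qed.

Definition cycle_deleted : structure cycle_sig := induced start_kept.

Let interp_del R (t : (ar R).-tuple cycle_deleted) :
  (t \in interp cycle_deleted R) = holds R (map val t).
Proof. by rewrite !inE. Qed.

Lemma kept_closed (a b : all_cycles) : a \in kept -> gaifman a b -> b \in kept.
Proof.
rewrite !inE => aw /(gaifman_next interp_all)[/= ->//|].
by move=> ab; move: aw; rewrite ab.
Qed.

Lemma degree_all_cycles : degree all_cycles <= 2.
Proof. exact: (degree_cycles _ interp_all). Qed.

Lemma degree_cycle_deleted : degree cycle_deleted <= 2.
Proof. by apply: (degree_cycles _ interp_del); apply: val_inj. Qed.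

(** The root for [w] on the first side is kept, but a match would be a second-side root reading [w],
    and that one lay on the deleted cycle. *)
Lemma cycle_deleted_unmatched : ~ models cycle_deleted (words_matched h).
Proof.
pose a : cycle_deleted := exist (fun x => x \in kept) _ start_kept.
have next_closed (x : cycle_deleted) : exists y : cycle_deleted,
    val y = next (val x).
  have xk : next (val x) \in kept by have := valP x; rewrite !inE.
  by exists (exist (fun x => x \in kept) _ xk).
move/(_ (fun=> a))/(sat_words_matched interp_del next_closed).
move=> /(_ a); rewrite /is_root eqxx => /(_ isT)[b /is_rootP bE] H.
have := valP b; rewrite inE bE /= => /eqP[].
congr (_, _); apply/ffunP => -[j jn].
by have := H j jn; rewrite bE !label_start.
Qed.

End Deletion.

Lemma words_matched_bs_size h (psi : formula cycle_sig) :
  bs_normal_form psi -> equivalent_deg 2 psi (words_matched h) ->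
  2 ^ (2 ^ h + 1) < fsize psi.
Proof.
case=> ys [z [phi [-> uniq_ys fv_phi [r loc]]]] equiv.
(* Each existential quantifier contributes two letters and the universal one makes the bound strict,
   so [2 ^ (2 ^ h) <= size ys] suffices. *)
rewrite fsize_foldr_Ex fsize_All addn1 expnS mul2n !addnS ltnS.
apply: leqW; apply: leq_trans (leq_addr _ _); rewrite leq_double leqNgt.
apply/negP => ys_small; have A_deg := degree_all_cycles h.
have/(equiv _ A_deg) A_psi := all_cycles_matched (h := h).
have [a _] := card_gt0P (node_gt0 h).
have/sat_foldr_Ex[t _ /= /forallP t_phi] := A_psi (fun=> a).
(* Pigeonhole: there are [2 ^ (2 ^ h)] words, more than there are witnesses [t y]. *)
have [w w_missed] : exists w, w \notin [seq (t y).1.2 | y <- ys].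
  apply/existsP; apply: contraLR ys_small; rewrite negb_exists => /forallP H.
  rewrite -leqNgt -(size_map (fun y => (t y).1.2)).
  rewrite -[leqLHS](_ : #|{ffun 'I_(2 ^ h) -> bool}| = _); last first.
    by rewrite card_ffun card_bool card_ord.
  apply: leq_trans (card_size _); apply/subset_leq_card/subsetP => w _.
  by have := H w; rewrite negbK.
apply: (@cycle_deleted_unmatched h w).
apply/(equiv _ (degree_cycle_deleted w)) => s; apply/sat_foldr_Ex.
(* The old witnesses all survive the deletion, so on [ys] the default [s x] of [insubd] is never
   taken. *)
exists (fun x => if x \in ys then insubd (s x) (t x) else s x).
  by move=> x /negPf ->.
rewrite /=; apply/forallP => c.
(* By locality [phi] may be evaluated in [all_cycles], where [t_phi] holds for every value of [z],
   in particular for [val c]. *)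
rewrite (sat_induced_local (@kept_closed _ w) _ loc).
rewrite (@eq_sat_fv _ _ _ _ (upd t z (val c))); first exact: t_phi.
move=> x /fv_phi; rewrite mem_rcons inE /= /upd; case: eqP => //= _ x_ys.
rewrite x_ys val_insubd ifT // inE; apply: contra w_missed => /eqP tx.
by apply/mapP; exists x; rewrite ?tx.
Qed.

Theorem theorem12 :
  exists (sg : signature) (phi : nat -> formula sg),
    [/\ forall h : nat, 1 <= h -> sentence (phi h),
        exists C : nat, forall h : nat, 1 <= h -> fsize (phi h) <= C * h
      & forall h : nat, 1 <= h ->
          forall psi : formula sg,
            bs_normal_form psi -> equivalent_deg 2 psi (phi h) ->
            2 ^ (2 ^ h + 1) < fsize psi].
Proof.
exists cycle_sig, words_matched; split=> [h _||h _ psi].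
- exact: sentence_words_matched.
- by exists 200 => h; apply: fsize_words_matched.
- exact: words_matched_bs_size.
Qed.
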